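(* Let $q=p^e$ be a prime power ($p$ prime, $e\ge1$). Then the group $F(S[t,t^{-1}])$, with $S=S(q)=\mathcal{R}/\mathcal{I}(q)\Sigma$, is solvable, and its derived length is at most $k$ whenever $k$ is a positive integer with $2^{k-1}\ge e(p^e-p^{e-1})+1$.
   Context: $\mathcal{R}=\mathbb{Z}[x,x^{-1},y,y^{-1}]$; positive units of $\mathcal{R}$ are the monomials $x^iy^j$. $\Sigma$ is the augmentation ideal of $\mathcal{R}$ (kernel of $x,y\mapsto1$ to $\mathbb{Z}$). $\mathcal{I}(q)$ is the ideal of $\mathcal{R}$ generated by all $1+u+\dots+u^{q-1}$, $u$ a positive unit. Let $M_1=\begin{pmatrix}1&1-y\\0&x\end{pmatrix}$ and $M_2T=\begin{pmatrix}yt&0\\1-xt&1\end{pmatrix}$ (matrices over $\mathcal{R}[t,t^{-1}]$). $F(S[t,t^{-1}])$ is the subgroup of $GL_2(S[t,t^{-1}])$ generated by the images of $M_1$ and $M_2T$ under entrywise reduction of coefficients from $\mathcal{R}$ to $S$ (with $t$ unchanged). Derived length $\le k$ means the $k$-th derived subgroup is trivial. *)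

(* Defs.v *)
From HB Require Import structures.
From mathcomp Require Import all_boot all_order all_algebra.
Set Implicit Arguments.
Unset Strict Implicit.
Unset Printing Implicit Defensive.
Import GRing.Theory.
Local Open Scope ring_scope.

Definition mx2 (A : nzRingType) (a b c d : A) : 'M[A]_2 :=
  \matrix_(i < 2, j < 2)
     if (i == 0 :> nat) then (if (j == 0 :> nat) then a else b)
     else (if (j == 0 :> nat) then c else d).

(* ---------- the ring S(q) = R / I(q)Sigma, via its universal property ----------
   R = Z[x,x^-1,y,y^-1] is the free commutative ring on two units x, y.
   I(q) Sigma is generated (as an ideal) by the products
   (1 + u + ... + u^(q-1)) * s  with u = x^i y^j (i, j in Z) a positive unit
   and s in {x - 1, y - 1} (the generators of the augmentation ideal Sigma). *)
Definition Sq_rel (q : nat) (B : comUnitRingType) (a b : B) : Prop :=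
  a \is a GRing.unit /\ b \is a GRing.unit /\
  forall i j : int,
    (\sum_(l < q) (a ^ i * b ^ j) ^+ l) * (a - 1) = 0 /\
    (\sum_(l < q) (a ^ i * b ^ j) ^+ l) * (b - 1) = 0.

(* (S, x, y) is (isomorphic to) R / I(q) Sigma with x, y the images of x, y:
   the relations hold, and S is initial among commutative rings with two
   elements satisfying them. *)
Definition is_Sq (q : nat) (S : comUnitRingType) (x y : S) : Prop :=
  Sq_rel q x y /\
  (forall (B : comUnitRingType) (a b : B), Sq_rel q a b ->
     exists f : {rmorphism S -> B}, f x = a /\ f y = b) /\
  (forall (B : comUnitRingType) (f g : {rmorphism S -> B}),
     f x = g x -> f y = g y -> forall s, f s = g s).

Definition is_Laurent (S L : comUnitRingType) (iota : {rmorphism S -> L})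
  (t : L) : Prop :=
  t \is a GRing.unit /\
  (forall (B : comUnitRingType) (phi : {rmorphism S -> B}) (b : B),
     b \is a GRing.unit ->
     exists psi : {rmorphism L -> B},
       (forall s, psi (iota s) = phi s) /\ psi t = b) /\
  (forall (B : comUnitRingType) (f g : {rmorphism L -> B}),
     (forall s, f (iota s) = g (iota s)) -> f t = g t -> forall u, f u = g u).

Inductive gen_subgroup (L : comUnitRingType) (P : 'M[L]_2 -> Prop)
  : 'M[L]_2 -> Prop :=
| gs_gen g : P g -> gen_subgroup P g
| gs_one : gen_subgroup P 1%:M
| gs_mul g h : gen_subgroup P g -> gen_subgroup P h -> gen_subgroup P (g *m h)
| gs_inv g : gen_subgroup P g -> gen_subgroup P (invmx g).

Definition commutator2 (L : comUnitRingType) (g h : 'M[L]_2) : 'M[L]_2 :=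
  invmx g *m invmx h *m g *m h.

Fixpoint derived (L : comUnitRingType) (G : 'M[L]_2 -> Prop) (n : nat)
  : 'M[L]_2 -> Prop :=
  match n with
  | 0 => G
  | n'.+1 => gen_subgroup (fun c => exists g h,
                 derived G n' g /\ derived G n' h /\ c = commutator2 g h)
  end.

Definition derived_length_le (L : comUnitRingType) (G : 'M[L]_2 -> Prop)
  (k : nat) : Prop :=
  forall g, derived G k g -> g = 1%:M.

Definition solvable_grp (L : comUnitRingType) (G : 'M[L]_2 -> Prop) : Prop :=
  exists k, derived_length_le G k.

Definition F_group (S L : comUnitRingType) (iota : {rmorphism S -> L})
  (x y : S) (t : L) : 'M[L]_2 -> Prop :=
  gen_subgroup (fun g =>
    g = mx2 1 (1 - iota y) 0 (iota x) \/
    g = mx2 (iota y * t) 0 (1 - iota x * t) 1).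

(* Main.v *)
Require Import Defs.
From HB Require Import structures.
From mathcomp Require Import all_boot all_order all_algebra.
From mathcomp Require Import qpoly ring zify.

(** Write X = x - 1, Y = y - 1 and phi = totient q.

    Modulo Sigma the two generators commute, so the commutator subgroup lies in the
    congruence subgroup of level Sigma; as [1 + Sigma^m, 1 + Sigma^n] is contained in
    1 + Sigma^(m+n), the k-th derived subgroup is = 1 mod Sigma^(2^(k-1)).  It remains
    to see that Sigma^(e phi + 1) = 0 in S, i.e. that Sigma^(e phi) is contained in I(q).

    For this, work in the group ring of (Z/q)^2, which has no p-torsion, with a monomial
    s = X^a Y^b, a + b = e phi, a <= b.  Write N(u) = 1 + ... + u^(q-1) and
    N_c = N(x y^(-c)).  Counting gives q = sum_(c<q) N_c - sum_(0<l<q) x^l N(y^(-l)), so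
    it is enough to show that s times each of the two sums lies in q I(q).
    - Second sum: for l of valuation v, Y^phi(p^v) is congruent mod p to the p^v-th
      cyclotomic polynomial, and b >= e phi(p^v) factors Y produce the missing p-powers.
    - First sum: s N_c = [c]^a Y^(e phi) N_c with [c] = 1 + ... + y^(c-1), while
      Y^(e phi) = q g + p^(e-1) g' Phi with Phi the q-th cyclotomic polynomial in y.
      As Phi N_c depends only on c mod p^(e-1), the terms with Phi add up to a multiple
      of p.
    Hence q s lies in q I(q), and q can be cancelled. *)

Set Implicit Arguments.
Unset Strict Implicit.
Unset Printing Implicit Defensive.

Import GRing.Theory.
Local Open Scope ring_scope.

(** * Geometric sums *)

Lemma sum_nat_blocks (V : nmodType) (m n : nat) (F : nat -> V) :
  \sum_(c < m * n) F c = \sum_(i < m) \sum_(j < n) F (i + m * j)%N.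
Proof.
rewrite exchange_big /=; elim: n => [|n IHn].
  by rewrite muln0 !big_ord0.
rewrite big_ord_recr /= -IHn mulnS addnC big_split_ord /=.
by congr (_ + _); apply: eq_bigr => i _; rewrite addnC.
Qed.

Definition geom (R : pzRingType) (n : nat) (u : R) : R := \sum_(l < n) u ^+ l.

Section Geometric.
Variable R : comNzRingType.
Implicit Types (u a b c : R) (m n k : nat).

Lemma geom1 n : geom n (1 : R) = n%:R.
Proof.
rewrite /geom (eq_bigr (fun=> 1)) ?sumr_const ?card_ord // => i _.
by rewrite expr1n.
Qed.

Lemma geom_sub1 n u : (u - 1) * geom n u = u ^+ n - 1.
Proof. by rewrite subrX1. Qed.

Lemma geomD m n u : geom (m + n) u = geom m u + u ^+ m * geom n u.
Proof.
rewrite /geom big_split_ord /= mulr_sumr; congr (_ + _).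
by apply: eq_bigr => i _; rewrite exprD.
Qed.

Lemma geomM m n u : geom (m * n) u = geom m u * geom n (u ^+ m).
Proof.
rewrite /geom (sum_nat_blocks _ _ (fun l => u ^+ l)) mulr_suml.
apply: eq_bigr => i _; rewrite mulr_sumr; apply: eq_bigr => j _.
by rewrite exprD exprM.
Qed.

(** This is [((1 + a) ^+ n - 1) / a]; induction replaces the division, as [a] may be a zero
    divisor. *)
Lemma geom_binomial n a :
  geom n (1 + a) = \sum_(k < n) a ^+ k *+ 'C(n, k.+1).
Proof.
elim: n => [|n IHn]; first by rewrite /geom !big_ord0.
rewrite -addn1 geomD IHn /geom big_ord1 expr0 mulr1 exprDn addn1.
under [in RHS]eq_bigr => k _ do rewrite binS mulrnDr.
rewrite big_split /=; congr (_ + _); last first.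
  by apply: eq_bigr => i _; rewrite expr1n mul1r.
by rewrite big_ord_recr /= bin_small // mulr0n addr0.
Qed.

(** Substitutes [b] for [a] next to a factor [c] on which they agree. It serves for relations that
    hold only after multiplication by a norm such as [N c] or [Phi]. *)
Lemma mulX_fixed a b c k : a * c = b * c -> a ^+ k * c = b ^+ k * c.
Proof.
move=> abc; elim: k => [|k IHk]; first by rewrite !expr0.
by rewrite !exprS -mulrA IHk mulrCA abc; ring.
Qed.

Lemma exp_fixed a c k : a * c = c -> a ^+ k * c = c.
Proof. by move=> ac; rewrite (@mulX_fixed _ 1) ?expr1n mul1r. Qed.

Lemma mul_geom_fixed n u a : u * a = a -> geom n u * a = n%:R * a.
Proof.
move=> ua; rewrite /geom mulr_suml (eq_bigr (fun=> a)).
  by rewrite sumr_const card_ord mulr_natl.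
by move=> i _; rewrite exp_fixed.
Qed.

Lemma geom_fixed n u : u ^+ n = 1 -> u * geom n u = geom n u.
Proof.
move=> un; apply/eqP; rewrite -subr_eq0 -{2}[geom n u]mul1r -mulrBl geom_sub1.
by rewrite un subrr.
Qed.

(** * Congruences modulo a prime *)

Definition cong n a b := exists d, a = b + n%:R * d.

Lemma cong_exp n a b k : cong n a b -> cong n (a ^+ k) (b ^+ k).
Proof.
move=> [d ->]; elim: k => [|k [d' IHk]]; first by exists 0; rewrite mulr0 addr0.
by exists (d * b ^+ k + b * d' + n%:R * d * d'); rewrite !exprS IHk; ring.
Qed.

Section Prime.
Variable p : nat.
Hypothesis p_pr : prime p.

Lemma frobenius_cong a b : cong p ((a + b) ^+ p) (a ^+ p + b ^+ p).
Proof.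
have p_gt0 := prime_gt0 p_pr.
exists (\sum_(i < p.-1) (a ^+ (p - i.+1) * b ^+ i.+1) *+ ('C(p, i.+1) %/ p)).
rewrite exprDn -(prednK p_gt0) big_ord_recl big_ord_recr /=.
rewrite /bump !add1n !prednK //. rewrite subn0 subnn !expr0 mulr1 mul1r bin0 binn !mulr1n.
rewrite [X in _ + X = _]addrC addrA; congr (_ + _).
rewrite mulr_sumr; apply: eq_bigr => i _; rewrite mulr_natl -mulrnA.
rewrite leq0n add1n divnK // prime_dvd_bin //.
by have := ltn_ord i; lia.
Qed.

Lemma frobenius_iter_cong a k : cong p ((1 + a) ^+ (p ^ k)) (1 + a ^+ (p ^ k)).
Proof.
elim: k => [|k IHk]; first by exists 0; rewrite !expr1 mulr0 addr0.
have [d Hd] := cong_exp p IHk.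
have [d' Hd'] := frobenius_cong 1 (a ^+ (p ^ k)).
exists (d' + d); rewrite expnSr [in LHS]exprM Hd Hd' expr1n exprM.
by rewrite mulrDr addrA.
Qed.

(** In [geom_binomial] every coefficient except the top one, ['C(p, p)], is divisible by [p]. *)
Lemma geom_prime_cong a : cong p (a ^+ p.-1) (geom p (1 + a)).
Proof.
have p_gt0 := prime_gt0 p_pr.
exists (- \sum_(i < p.-1) a ^+ i *+ ('C(p, i.+1) %/ p)).
have -> : geom p (1 + a) = geom p.-1.+1 (1 + a) by rewrite prednK.
rewrite geom_binomial big_ord_recr /= prednK // binn mulr1n mulrN mulr_sumr.
rewrite addrAC -sumrB big1 ?add0r // => i _.
rewrite mulr_natl -mulrnA divnK ?subrr // prime_dvd_bin //.
by have := ltn_ord i; lia.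
Qed.

(** The right side is the p^(k+1)-th cyclotomic polynomial at [u]. Modulo [p], Frobenius turns
    [(u - 1) ^+ (p ^ k)] into [u ^+ (p ^ k) - 1], and [geom_prime_cong] treats the power [p.-1] of
    the latter. *)
Lemma cyclotomic_cong u k :
  cong p ((u - 1) ^+ totient (p ^ k.+1)) (geom p (u ^+ (p ^ k))).
Proof.
have [d Hd] := geom_prime_cong (u ^+ (p ^ k) - 1).
have [d' Hd'] := frobenius_iter_cong (u - 1) k.
have u1 : 1 + (u - 1) = u by rewrite addrC subrK.
rewrite u1 in Hd'.
have [|d'' Hd''] := @cong_exp p ((u - 1) ^+ (p ^ k)) (u ^+ (p ^ k) - 1) p.-1.
  by exists (- d'); rewrite Hd'; ring.
exists (d + d''); rewrite totient_pfactor // mulnC exprM Hd'' Hd.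
by rewrite [1 + _]addrC addrNK mulrDr addrA.
Qed.

End Prime.
End Geometric.

(** * One variable *)

Record is_ideal (R : pzRingType) (I : R -> Prop) : Prop := IsIdeal {
  ideal0 : I 0;
  idealD : forall a b, I a -> I b -> I (a + b);
  idealM : forall a b, I b -> I (a * b) }.

(** The ideal n I, which may be smaller than the intersection of I with n R: cancelling [n] has to
    leave an element of [I]. *)
Definition natmul_ideal (R : pzRingType) (I : R -> Prop) (n : nat) (a : R) :=
  exists2 b, I b & a = n%:R * b.

Section IdealMultiples.
Variables (R : comNzRingType) (I : R -> Prop).
Hypothesis idI : is_ideal I.
Implicit Types a b : R.

Lemma idealB a b : I a -> I b -> I (a - b).
Proof. by move=> Ia Ib; apply: idealD => //; rewrite -mulN1r; apply: idealM. Qed.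

Lemma ideal_sum (J : Type) (r : seq J) (P : pred J) (F : J -> R) :
  (forall j, P j -> I (F j)) -> I (\sum_(j <- r | P j) F j).
Proof. by move=> IF; apply: big_ind => //; [apply: ideal0 | apply: idealD]. Qed.

Lemma natmul_is_ideal n : is_ideal (natmul_ideal I n).
Proof.
split; first by exists 0; [apply: ideal0 | rewrite mulr0].
  by move=> _ _ [a Ia ->] [b Ib ->]; exists (a + b); [apply: idealD | rewrite mulrDr].
by move=> a _ [b Ib ->]; exists (a * b); [apply: idealM | rewrite mulrCA].
Qed.

Lemma mul_natmul_ideal m n a :
  natmul_ideal I m a -> natmul_ideal I (n * m) (n%:R * a).
Proof. by move=> [b Ib ->]; exists b; rewrite // natrM mulrA. Qed.

Lemma natmul_ideal1 n a : I a -> natmul_ideal I n (n%:R * a).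
Proof. by exists a. Qed.

Lemma dvdn_natmul_ideal m n a : (m %| n)%N -> I a -> natmul_ideal I m (n%:R * a).
Proof.
move=> /dvdnP [k ->] Ia; exists (k%:R * a); first exact: idealM.
by rewrite natrM; ring.
Qed.
End IdealMultiples.

Section PrimePower.
Variables (p e : nat).
Hypotheses (p_pr : prime p) (e_gt0 : (0 < e)%N).
Local Notation q := (p ^ e)%N.

(** The ratio of the two totients is [p] for [e > 1] and [p - 1] for [e = 1]. So an exponent that is
    at least half of [e * totient q] still reaches [e * totient (p ^ e.-1)]. *)
Lemma totient_pred_double : q != 2 -> (totient (p ^ e.-1) * 2 <= totient q)%N.
Proof.
have p_gt1 := prime_gt1 p_pr.
case: e e_gt0 => // -[|k] _ /=; rewrite ?expn1 => p_neq2.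
  rewrite expn0 (_ : totient 1 = 1)%N // mul1n totient_prime //; lia.
by rewrite !totient_pfactor //= expnS -mulnA leq_mul2l mulnC leq_mul2r p_gt1 !orbT.
Qed.

Lemma leq_totient_pexp m n :
  (m <= n)%N -> (totient (p ^ m) <= totient (p ^ n))%N.
Proof.
have p_gt1 := prime_gt1 p_pr; have p_gt0 := prime_gt0 p_pr.
case: n => [|n]; first by rewrite leqn0 => /eqP ->.
case: m => [|m] le_mn; first by rewrite totient_gt0 expn_gt0 p_gt0.
by rewrite !totient_pfactor //= leq_mul2l leq_pexp2l ?orbT.
Qed.

Section OneVariable.
Variables (R : comNzRingType) (y : R) (I : R -> Prop).
Hypotheses (idI : is_ideal I) (y_q : y ^+ q = 1).
Hypothesis I_geom : forall i, I (geom q (y ^+ i)).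
Local Notation Y := (y - 1).
(* [tail v] is the sum of the elements of the subgroup generated by y^(p^v). *)
Local Notation tail v := (geom (p ^ (e - v)) (y ^+ (p ^ v))).

Lemma geom_tail v : (v <= e)%N -> geom q (y ^+ (p ^ v)) = (p ^ v)%:R * tail v.
Proof.
move=> le_ve; have -> : q = (p ^ (e - v) * p ^ v)%N by rewrite -expnD subnK.
by rewrite geomM -exprM -expnD subnKC // y_q geom1 mulrC.
Qed.

Lemma cyclotomic_tail v :
  (v < e)%N -> geom p (y ^+ (p ^ v)) * tail v.+1 = tail v.
Proof.
move=> lt_ve; rewrite expnSr exprM -geomM -expnS.
by rewrite -subSn.
Qed.

(** Since [p ^ v] times the tail is in [I], [v + k] powers of [p] would suffice; [i] are present and
    [d] are missing. Each block of [totient (p ^ v)] factors [Y] makes up for one: by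
    [cyclotomic_cong] it is a multiple of [p], which raises [i], plus a cyclotomic factor, which
    lowers [v]. *)
Lemma pow_tail v k d i m : (v <= e)%N -> (i + d = v + k)%N ->
  (d * totient (p ^ v) <= m)%N ->
  natmul_ideal I (p ^ k) ((p ^ i)%:R * (Y ^+ m * tail v)).
Proof.
elim: v d i m => [|v IHv] d i m le_ve; last elim: d i m => [|d IHd] i m.
(* At [v = 0] the tail is [geom q y]: it is in [I] if no power is missing, and otherwise one factor
   [Y] kills it. *)
- case: d => [|d]; rewrite ?addn0 add0n (_ : totient 1 = 1)%N // muln1.
    move=> -> _; apply: natmul_ideal1; apply: idealM => //.
    by have := I_geom 1; rewrite !expr1 subn0.
  case: m => // m _ _; rewrite expr1 subn0 exprSr -mulrA geom_sub1 y_q subrr.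
  by rewrite !mulr0; apply: ideal0; apply: natmul_is_ideal.
- rewrite addn0 => -> _; rewrite addnC expnD natrM mulrCA -mulrA.
  rewrite -geom_tail // mulrCA; apply: natmul_ideal1.
  exact: idealM.
move=> Hi Hm.
have phi_le : (totient (p ^ v) <= totient (p ^ v.+1))%N.
  exact: leq_totient_pexp.
move: Hm; rewrite mulSn => Hm.
have le_m' : (d * totient (p ^ v.+1) <= m - totient (p ^ v.+1))%N by lia.
have /subnKC <- := leq_trans (leq_addr _ _) Hm.
move: (m - _)%N le_m' => m' le_m'.
have [D HD] := cyclotomic_cong p_pr y v.
rewrite exprD HD.
have -> : (p ^ i)%:R * ((geom p (y ^+ (p ^ v)) + p%:R * D) * Y ^+ m' * tail v.+1)
  = (p ^ i)%:R * (Y ^+ m' * (geom p (y ^+ (p ^ v)) * tail v.+1)) +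
    D * ((p ^ i.+1)%:R * (Y ^+ m' * tail v.+1)).
  by rewrite (expnS p i) natrM; ring.
have idpI := natmul_is_ideal idI (p ^ k).
apply: idealD => //; last by apply: idealM => //; apply: IHd; lia.
rewrite cyclotomic_tail //; apply: (IHv d); [lia|lia|].
exact: leq_trans (leq_mul (leqnn d) phi_le) le_m'.
Qed.

Lemma pow_geom_multiple v m : (v < e)%N -> (e * totient (p ^ v) <= m)%N ->
  natmul_ideal I q (Y ^+ m * geom q (y ^+ (p ^ v))).
Proof.
move=> lt_ve le_m; rewrite geom_tail 1?ltnW // mulrCA.
have -> : q = (p ^ v * p ^ (e - v))%N by rewrite -expnD subnKC // ltnW.
apply: mul_natmul_ideal; rewrite -[X in natmul_ideal _ _ X]mul1r.
(* With [i = 0] all [v + k = e] powers are missing; hence the factor [e] in the exponent. *)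
by apply: (@pow_tail v (e - v) e 0) => //; rewrite ?subnKC // ltnW.
Qed.
End OneVariable.
End PrimePower.

(** * Two variables *)

Section Lines.
Variables (p e : nat).
Hypotheses (p_pr : prime p) (e_gt0 : (0 < e)%N).
Local Notation q := (p ^ e)%N.
Local Notation Q := (p ^ e.-1)%N.

Lemma mulQp : q = (Q * p)%N.
Proof. by rewrite -expnSr prednK. Qed.

(** With [l'] the part of [l] prime to [p], [z = y ^+ l'] has [y] among its powers. So [y - 1] is a
    multiple of [z - 1], and [pow_geom_multiple] applies to [z]. *)
Lemma pow_geom_multiple_gen (R : comNzRingType) (y : R) (I : R -> Prop) l m :
  is_ideal I -> y ^+ q = 1 -> (forall i, I (geom q (y ^+ i))) ->
  ~~ (q %| l)%N -> (e * totient Q <= m)%N ->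
  natmul_ideal I q ((y - 1) ^+ m * geom q (y ^+ l)).
Proof.
move=> idI y_q I_geom ndv_ql le_m.
have l_gt0 : (0 < l)%N by case: l ndv_ql => //; rewrite dvdn0.
have [l' co_pl' def_l] := pfactor_coprime p_pr l_gt0.
set v := logn p l in def_l.
have lt_ve : (v < e)%N by rewrite ltnNge -pfactor_dvdn.
have q_gt0 : (0 < q)%N by rewrite expn_gt0 prime_gt0.
have l'_gt0 : (0 < l')%N by case: l' def_l l_gt0 {co_pl'} => // ->.
have [[a b] /= Hab] : exists u : nat * nat, (u.1 * l' - u.2 * q)%N = 1%N.
  by apply/coprimeP; rewrite // coprime_sym coprimeXl.
pose z := y ^+ l'.
have yz : y = z ^+ a.
  have -> : z ^+ a = y ^+ (b * q + 1).
    by rewrite -exprM; congr (_ ^+ _); lia.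
  by rewrite exprD mulnC exprM y_q expr1n mul1r.
have Y_z : y - 1 = geom a z * (z - 1) by rewrite mulrC geom_sub1 -yz.
rewrite Y_z exprMn -mulrA def_l exprM -/z.
apply: idealM; first exact: natmul_is_ideal.
apply: pow_geom_multiple => //.
- by rewrite -exprM mulnC exprM y_q expr1n.
- by move=> i; rewrite -exprM.
apply: leq_trans le_m; rewrite leq_mul2l leq_totient_pexp ?orbT //; lia.
Qed.

(** Induction on [j]: the new factor is Phi + p D, with Phi = [geom p (y ^+ Q)]. It sends Phi to a
    multiple of p Phi, since modulo [p] it contains [(y - 1) ^+ Q], that is [y ^+ Q - 1], which
    kills Phi. *)
Lemma cyclotomic_decomposition (R : comNzRingType) (y : R) (j : nat) :
  y ^+ q = 1 -> exists g g',
  (y - 1) ^+ (j.+1 * totient q) =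
    (p ^ j.+1)%:R * g + (p ^ j)%:R * g' * geom p (y ^+ Q).
Proof.
move=> y_q; have p_gt1 := prime_gt1 p_pr.
have [D] := cyclotomic_cong p_pr y e.-1; rewrite prednK // => HD.
have [D' HD'] := frobenius_iter_cong p_pr (y - 1) e.-1.
have PhiY : (y - 1) ^+ totient q * geom p (y ^+ Q) =
    p%:R * (- D' * (y - 1) ^+ (totient q - Q)) * geom p (y ^+ Q).
  have /subnK {1}<- : (Q <= totient q)%N.
    by rewrite totient_pfactor // leq_pmull //; lia.
  have : (y ^+ Q - 1) * geom p (y ^+ Q) = 0.
    by rewrite geom_sub1 -exprM -mulQp y_q subrr.
  have -> : y ^+ Q = 1 + (y - 1) ^+ Q + p%:R * D'.
    by rewrite -HD' [1 + _]addrC subrK.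
  rewrite exprD; set P := geom _ _ => H0.
  have H1 : (y - 1) ^+ Q * P = - (p%:R * D' * P).
    by apply/eqP; rewrite -subr_eq0 -H0; apply/eqP; ring.
  by rewrite -mulrA H1; ring.
elim: j => [|j [g [g' IHj]]].
  by exists D, 1; rewrite mul1n HD !expn1 expn0; ring.
exists (g * D), (g - g' * D' * (y - 1) ^+ (totient q - Q)).
rewrite mulSn exprD IHj mulrDr -!mulrA [X in _ + X = _](_ : _ =
  (p ^ j)%:R * g' * ((y - 1) ^+ totient q * geom p (y ^+ Q))); last by ring.
by rewrite PhiY HD !expnS !natrM; ring.
Qed.

(** Telescoping (c+1)^(al+1) - c^(al+1) up to [p] expresses p^(al+1) through the power sums of
    exponent at most [al]. The last one has coefficient [al.+1], which is prime to [p]. *)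
Lemma power_sum_dvd al : (al < p.-1)%N -> (p %| \sum_(c < p) c ^ al)%N.
Proof.
elim/ltn_ind: al => al IHal al_lt.
have binom n : (n ^ al.+1 = \sum_(k < al.+1) 'C(al.+1, k) * \sum_(c < n) c ^ k)%N.
  elim: n => [|n IHn].
    by rewrite exp0n // big1 // => k _; rewrite big_ord0 muln0.
  rewrite -add1n expnDn big_ord_recr /= subnn mul1n binn mul1n IHn addnC.
  rewrite -big_split /=; apply: eq_bigr => k _.
  by rewrite exp1n mul1n big_ord_recr /= mulnDr.
have : (p %| p ^ al.+1)%N by rewrite dvdn_exp.
rewrite binom big_ord_recr /= binSn dvdn_addr.
  rewrite Gauss_dvdr // prime_coprime // gtnNdvd //; lia.
apply: dvdn_sum => k _; apply: dvdn_mull; apply: IHal => //.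
by have := ltn_ord k; lia.
Qed.

(* Only p = 2 with [al] odd needs an argument; there [al * 2 <= e * totient q] excludes
   e = 2, al = 3, for which the divisibility fails. *)
Lemma half_power_sum_dvd al : (1 < e)%N -> (al * 2 <= e * totient q)%N ->
  (p %| al * 'C(p, 2) * \sum_(c < Q) c ^ al.-1)%N.
Proof.
move=> e_gt1 le_al; have p_gt1 := prime_gt1 p_pr.
have [p2|p_neq2] := eqVneq p 2; last first.
  apply: dvdn_mulr; apply: dvdn_mull; apply: prime_dvd_bin => //.
  by move: p_neq2; lia.
move: le_al; rewrite p2 totient_pfactor // binn muln1 mul1n => le_al.
case odd_al: (odd al); last by rewrite dvdn_mulr // dvdn2 odd_al.
have [->|al_neq1] := eqVneq al 1%N.
  rewrite mul1n (eq_bigr (fun=> 1%N)) => [|i _]; last by rewrite expn0.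
  by rewrite sum1_card card_ord dvdn_exp //; lia.
apply: dvdn_mull; rewrite dvdn2.
have e_ge3 : (2 < e)%N.
  rewrite ltnNge; apply/negP => e_le2; have e2 : e = 2 by lia.
  by move: le_al odd_al al_neq1; rewrite e2; case: al => [|[|[|]]].
have -> : (2 ^ e.-1 = 2 ^ (e - 3) * 4)%N.
  by rewrite -[4%N]/(2 ^ 2)%N -expnD; congr (_ ^ _)%N; lia.
(* As [al.-1 > 0], each term has the parity of [c], and four consecutive [c] contain two odd
   ones. *)
elim: (2 ^ (e - 3))%N => [|n IHn]; first by rewrite big_ord0.
rewrite mulSn addnC !addnS addn0 !big_ord_recr /= !oddD (negbTE IHn) !oddX /=.
have -> /= : (al.-1 == 0)%N = false by apply/negbTE; lia.
by rewrite oddM andbF.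
Qed.

Section TwoVariables.
Variables (R : comNzRingType) (x y : R) (I : R -> Prop).
Hypotheses (idI : is_ideal I) (x_q : x ^+ q = 1) (y_q : y ^+ q = 1).
Hypothesis I_geom : forall i j, I (geom q (x ^+ i * y ^+ j)).
(* [w] is the inverse of [y]; it avoids assuming that [R] has inverses. *)
Local Notation w := (y ^+ q.-1).
Local Notation Phi := (geom p (y ^+ Q)).
Local Notation N c := (geom q (x * w ^+ c)).

Let q_gt0 : (0 < q)%N.
Proof. by rewrite expn_gt0 prime_gt0. Qed.

Let yw : y * w = 1.
Proof. by rewrite -exprS prednK. Qed.

Let w_q : w ^+ q = 1.
Proof. by rewrite exprAC y_q expr1n. Qed.

Let I_N c : I (N c).
Proof. by have := I_geom 1 (q.-1 * c); rewrite expr1 exprM. Qed.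

(** [N c] absorbs [x * w ^+ c], the element whose powers it sums. *)
Lemma x_on_line c : x * N c = y ^+ c * N c.
Proof.
have : x * w ^+ c * N c = N c.
  by rewrite geom_fixed // exprMn x_q mul1r (exprAC w c q) w_q expr1n.
move/(congr1 (fun a => y ^+ c * a)) => <-.
rewrite [RHS](_ : _ = y ^+ c * w ^+ c * (x * N c)); last first.
  by rewrite -[x * w ^+ c * _]mulrA [w ^+ c * _]mulrC; ring.
by rewrite -exprMn yw expr1n mul1r.
Qed.

Lemma monomial_on_line al be c :
  (x - 1) ^+ al * (y - 1) ^+ be * N c =
  geom c y ^+ al * (y - 1) ^+ (al + be) * N c.
Proof.
have H : (x - 1) * N c = (y ^+ c - 1) * N c by rewrite !mulrBl x_on_line.
rewrite mulrAC (mulX_fixed al H) -geom_sub1 exprMn exprD; ring.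
Qed.

(** After exchanging the sums over [c] and over the powers of [x], the term of exponent 0 gives
    [q]. *)
Lemma sum_lines :
  \sum_(c < q) N c = q%:R + \sum_(l < q.-1) x ^+ l.+1 * geom q (w ^+ l.+1).
Proof.
have -> : \sum_(c < q) N c = \sum_(l < q) x ^+ l * geom q (w ^+ l).
  rewrite exchange_big /=; apply: eq_bigr => l _; rewrite mulr_sumr.
  by apply: eq_bigr => c _; rewrite exprMn (exprAC w).
pose F l := x ^+ l * geom q (w ^+ l).
have recl n : (0 < n)%N -> \sum_(l < n) F l = F 0 + \sum_(l < n.-1) F l.+1.
  by case: n => // n _; rewrite big_ord_recl.
by rewrite (recl _ q_gt0) {1}/F expr0 mul1r expr0 geom1.
Qed.

Lemma Phi_fixed k : y ^+ (Q * k) * Phi = Phi.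
Proof.
by rewrite exprM exp_fixed // geom_fixed // -exprM -mulQp.
Qed.

Lemma Phi_line c d : Phi * N (c + Q * d) = Phi * N c.
Proof.
have wPhi : w ^+ (Q * d) * Phi = Phi by rewrite exprAC exp_fixed // Phi_fixed.
rewrite ![Phi * _]mulrC /geom !mulr_suml; apply: eq_bigr => l _.
rewrite -/(geom p (y ^+ Q)); apply: mulX_fixed.
by rewrite exprD -!mulrA wPhi.
Qed.

Lemma PhiQ : geom Q y * Phi = geom q y.
Proof. by rewrite -geomM -mulQp. Qed.

Lemma geom_block c d :
  geom (c + Q * d) y * Phi = (geom c y + d%:R * (y ^+ c * geom Q y)) * Phi.
Proof.
rewrite geomD geomM !mulrDl; congr (_ + _).
have -> : d%:R * (y ^+ c * geom Q y) * Phi = y ^+ c * geom Q y * (d%:R * Phi).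
  by ring.
rewrite -(@mul_geom_fixed _ d (y ^+ Q)); first by ring.
by have := Phi_fixed 1; rewrite muln1.
Qed.

(** Makes the quadratic terms in the expansion of [geom_block] multiples of [Q], so that only the
    linear ones matter. *)
Lemma geomQ_sqr : geom Q y ^+ 2 * Phi = Q%:R * (geom Q y * Phi).
Proof.
by rewrite expr2 -mulrA PhiQ mul_geom_fixed // geom_fixed.
Qed.

Lemma expand_two (a b : R) n : exists r,
  (a + b) ^+ n = a ^+ n + n%:R * (b * a ^+ n.-1) + b ^+ 2 * r.
Proof.
case: n => [|n]; first by exists 0; rewrite !expr0; ring.
elim: n => [|n [r IHn]]; first by exists 0; rewrite !expr1 expr0; ring.
exists (r * (a + b) + n.+1%:R * a ^+ n).
rewrite exprS IHn /= [a ^+ n.+2]exprS [a ^+ n.+1]exprS -!natr1; ring.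
Qed.

(** [geom q y] absorbs [w], so every line gives the same sum over all monomials. *)
Lemma geom_line_sum c : N c * geom q y = geom q x * geom q y.
Proof.
have wn : w ^+ c * geom q y = geom q y.
  by rewrite -exprM mulnC exprM; apply: exp_fixed; apply: exp_fixed; apply: geom_fixed.
rewrite [N c]/geom [geom q x]/geom !mulr_suml; apply: eq_bigr => l _.
by rewrite exprMn -mulrA (exp_fixed l wn).
Qed.

Lemma geom_coef_line al c :
  geom c y ^+ al * (N c * geom q y) = (c ^ al)%:R * (geom q x * geom q y).
Proof.
have H : geom c y * geom q y = c%:R * geom q y.
  by rewrite mul_geom_fixed // geom_fixed.
by rewrite mulrCA (mulX_fixed al H) natrX mulrCA geom_line_sum.
Qed.
(** By [geom_block] each summand is an [al]-th power of [geom c y + d%:R * b]. The constant terms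
    add up to the multiple of [p], the quadratic ones form [r], and the linear ones give ['C(p, 2)],
    the sum of all [d < p]. *)
Lemma line_power_sum_block al c : exists2 r, natmul_ideal I Q r &
  \sum_(d < p) geom (c + Q * d) y ^+ al * (Phi * N (c + Q * d)) =
  p%:R * (geom c y ^+ al * (Phi * N c)) + r +
  (al * 'C(p, 2) * c ^ al.-1)%:R * (geom q x * geom q y).
Proof.
pose b := y ^+ c * geom Q y.
have bG : b * geom c y ^+ al.-1 * (Phi * N c) =
    (c ^ al.-1)%:R * (geom q x * geom q y).
  rewrite -(geom_coef_line al.-1 c) -PhiQ.
  have H : y ^+ c * (geom Q y * Phi) = geom Q y * Phi.
    by rewrite PhiQ; apply: exp_fixed; apply: geom_fixed.
  by rewrite -[in RHS]H /b; ring.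
have term d : exists2 r, natmul_ideal I Q r &
    geom (c + Q * d) y ^+ al * (Phi * N (c + Q * d)) =
    geom c y ^+ al * (Phi * N c) + r +
    (al * d * c ^ al.-1)%:R * (geom q x * geom q y).
  have [r Hr] := expand_two (geom c y) (d%:R * b) al.
  exists (r * d%:R ^+ 2 * y ^+ c ^+ 2 * geom Q y * Phi * (Q%:R * N c)).
    by apply: idealM; [apply: natmul_is_ideal | apply: natmul_ideal1].
  rewrite Phi_line mulrA (mulX_fixed al (geom_block c d)) -/b Hr.
  rewrite !natrM -[al%:R * d%:R * _ * _]mulrA -bG.
  rewrite [RHS](_ : _ = (geom c y ^+ al + al%:R * (d%:R * b * geom c y ^+ al.-1)) *
     (Phi * N c) + d%:R ^+ 2 * y ^+ c ^+ 2 * r * N c * (Q%:R * (geom Q y * Phi)));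
    last by ring.
  by rewrite -geomQ_sqr /b; ring.
have -> : 'C(p, 2) = (\sum_(d < p) d)%N by rewrite -bin2_sum big_mkord.
(* The number of summands is freed from the [p] inside [Phi] and [Q], so that induction applies. *)
suff H n : exists2 r, natmul_ideal I Q r &
  \sum_(d < n) geom (c + Q * d) y ^+ al * (Phi * N (c + Q * d)) =
  n%:R * (geom c y ^+ al * (Phi * N c)) + r +
  (al * (\sum_(d < n) d) * c ^ al.-1)%:R * (geom q x * geom q y) by apply: H.
elim: n => [|n [r Ir IHn]].
  exists 0; first by apply: ideal0; apply: natmul_is_ideal.
  by rewrite !big_ord0 muln0 mul0n; ring.
have [r' Ir' Hr'] := term n.
exists (r + r'); first by apply: idealD => //; apply: natmul_is_ideal.
rewrite !big_ord_recr /= IHn Hr' mulnDr mulnDl natrD -natr1; ring.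
Qed.

(** For [e = 1], [Phi] is [geom q y] and the sum is a power sum times one element of [I]. For
    [e > 1], [p] divides [Q], so in each block of residues modulo [Q] only the linear terms remain
    to be controlled. *)
Lemma line_power_sum al :
  (e = 1%N -> p %| \sum_(c < p) c ^ al)%N ->
  ((1 < e)%N -> p %| al * 'C(p, 2) * \sum_(c < Q) c ^ al.-1)%N ->
  natmul_ideal I p (\sum_(c < q) geom c y ^+ al * (Phi * N c)).
Proof.
move=> H1 H2; have idpI := natmul_is_ideal idI p.
have IG : I (geom q x * geom q y).
  by apply: idealM => //; have := I_geom 0 1; rewrite expr0 mul1r expr1.
have [e_le1 | e_gt1] := leqP e 1.
  have e1 : e = 1%N by lia.
  have Q1 : Q = 1%N by rewrite e1.
  have -> : Phi = geom q y by rewrite -PhiQ Q1 /geom big_ord1 expr0 mul1r.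
  under eq_bigr => c _ do rewrite [geom q y * _]mulrC geom_coef_line.
  rewrite -mulr_suml -natr_sum; apply: dvdn_natmul_ideal => //.
  have -> : q = p by rewrite e1 expn1.
  exact: H1.
have dvd_pQ : (p %| Q)%N by rewrite dvdn_exp //; lia.
pose F c := geom c y ^+ al * (Phi * N c).
have -> : \sum_(c < q) F c = \sum_(c < Q * p) F c by rewrite -mulQp.
rewrite sum_nat_blocks /F.
suff H n : exists2 r, natmul_ideal I p r &
    \sum_(c < n) \sum_(d < p) geom (c + Q * d) y ^+ al * (Phi * N (c + Q * d))
    = r + (al * 'C(p, 2) * \sum_(c < n) c ^ al.-1)%:R * (geom q x * geom q y).
  have [r Ir ->] := H Q.
  by apply: idealD => //; apply: dvdn_natmul_ideal => //; apply: H2.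
elim: n => [|n [r Ir IHn]].
  by exists 0; [exact: ideal0 | rewrite !big_ord0 muln0; ring].
have [r' [s Is Hs] Hr'] := line_power_sum_block al n.
exists (r + (p%:R * (geom n y ^+ al * (Phi * N n)) + r')).
  apply: idealD => //; apply: idealD => //.
    by apply: natmul_ideal1; apply: idealM => //; apply: idealM.
  by rewrite Hs; apply: dvdn_natmul_ideal.
rewrite !big_ord_recr /= IHn Hr' mulnDr natrD; ring.
Qed.
Lemma monomial_in_ideal_le al be :
  (forall a : R, p%:R * a = 0 -> a = 0) ->
  (al + be = e * totient q)%N -> (al <= be)%N ->
  I ((x - 1) ^+ al * (y - 1) ^+ be).
Proof.
move=> tf Hab le_ab; have p_gt1 := prime_gt1 p_pr.
have idqI := natmul_is_ideal idI q.
have tfk k (a b : R) : (p ^ k)%:R * a = (p ^ k)%:R * b -> a = b.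
  elim: k => [|k IHk]; first by rewrite !mul1r.
  rewrite expnS natrM -!mulrA => /eqP; rewrite -subr_eq0 -mulrBr => /eqP /tf /eqP.
  by rewrite subr_eq0 => /eqP /IHk.
set s := (x - 1) ^+ al * (y - 1) ^+ be.
suff [b Ib /tfk ->] : natmul_ideal I q (q%:R * s) by [].
have -> : q%:R * s = \sum_(c < q) s * N c -
    \sum_(l < q.-1) s * (x ^+ l.+1 * geom q (w ^+ l.+1)).
  by rewrite -!mulr_sumr sum_lines mulrDr addrK mulrC.
apply: idealB => //.
  under eq_bigr => c _ do rewrite monomial_on_line Hab.
  have [g [g']] := cyclotomic_decomposition e.-1 y_q.
  rewrite prednK // => ->.
  have -> : \sum_(c < q) geom c y ^+ al * (q%:R * g + Q%:R * g' * Phi) * N c =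
      q%:R * (g * \sum_(c < q) geom c y ^+ al * N c) +
      g' * (Q%:R * \sum_(c < q) geom c y ^+ al * (Phi * N c)).
    move: Phi => P; rewrite !mulr_sumr -big_split /=; apply: eq_bigr => c _; ring.
  apply: idealD => //.
    apply: natmul_ideal1; apply: idealM => //; apply: ideal_sum => // c _.
    exact: idealM.
  apply: idealM => //; rewrite [X in natmul_ideal _ X]mulQp.
  (* For [e = 1], [al <= be] and [al + be = p - 1] force [al < p - 1]. *)
  apply: mul_natmul_ideal; apply: line_power_sum => [e1|e_gt1].
    apply: power_sum_dvd; move: Hab; rewrite e1 expn1 totient_prime //; lia.
  by apply: half_power_sum_dvd => //; lia.
apply: ideal_sum => // l _.
have -> : s * (x ^+ l.+1 * geom q (w ^+ l.+1)) = (x - 1) ^+ al * x ^+ l.+1 *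
    ((y - 1) ^+ be * geom q (y ^+ (q.-1 * l.+1))) by rewrite -exprM /s; ring.
apply: idealM => //; apply: pow_geom_multiple_gen => //.
- by move=> i; have := I_geom 0 i; rewrite expr0 mul1r.
- rewrite Gauss_dvdr; last by rewrite -[X in coprime X _](prednK q_gt0) coprimeSn.
  by rewrite gtnNdvd //; have := ltn_ord l; lia.
(* [be] is at least half of [e * totient q], which is enough unless [q = 2]; there [al = 0] and
   [be = 1]. *)
have [q2|/(totient_pred_double p_pr e_gt0) le2] := eqVneq q 2; last by nia.
have e1 : e = 1%N.
  by case: e e_gt0 q2 => // -[|k] // _; rewrite !expnS; have := prime_gt0 p_pr; nia.
by move: Hab; rewrite q2 e1 /= (_ : totient 1 = 1)%N // (_ : totient 2 = 1)%N //; lia.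
Qed.
End TwoVariables.

Lemma monomial_in_ideal (R : comNzRingType) (x y : R) (I : R -> Prop) al be :
  is_ideal I -> x ^+ q = 1 -> y ^+ q = 1 ->
  (forall i j, I (geom q (x ^+ i * y ^+ j))) ->
  (forall a : R, p%:R * a = 0 -> a = 0) ->
  (al + be = e * totient q)%N -> I ((x - 1) ^+ al * (y - 1) ^+ be).
Proof.
move=> idI x_q y_q I_geom tf Hab.
have [le_ab|/ltnW le_ba] := leqP al be; first exact: monomial_in_ideal_le.
rewrite mulrC; apply: monomial_in_ideal_le => //; last by rewrite addnC.
by move=> i j; rewrite mulrC.
Qed.
End Lines.

(** * Transfer from the integral group ring of the square of Z/q *)

Lemma qpoly_lift (K T : comNzRingType) (h : {poly K}) (phi : {rmorphism K -> T})
    (a : T) :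
  (1 < size h)%N -> h \is monic -> root (map_poly phi h) a ->
  exists psi : {rmorphism {poly %/ h} -> T},
    (forall k, psi (qpolyC h k) = phi k) /\ psi 'qX = a.
Proof.
move=> h_gt1 h_monic /rootP ha.
(* The quotient is taken by [mk_monic h], which defaults to ['X] unless [h] is monic and
   nonconstant. *)
have mk_h : mk_monic h = h by rewrite /mk_monic h_gt1 h_monic.
pose cfu k : GRing.comm a (phi k) := mulrC a (phi k).
pose ev : {rmorphism {poly K} -> T} := horner_morph cfu.
have ev_mod r : ev (in_qpoly h r) = ev r.
  rewrite {2}(Pdiv.RingMonic.rdivp_eq (monic_mk_monic h) r) rmorphD rmorphM /=.
  by rewrite [X in _ * X](_ : _ = 0) ?mulr0 ?add0r // mk_h.
pose f (r : {poly %/ h}) := ev r.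
have fD : zmod_morphism f by move=> r s; rewrite /f -rmorphB.
have fM : monoid_morphism f.
  split; first by rewrite /f /= -[polyC 1]/(1 : {poly K}) rmorph1.
  by move=> r s; rewrite /f -rmorphM; apply: ev_mod.
pose psi : {rmorphism {poly %/ h} -> T} := HB.pack f
  (GRing.isZmodMorphism.Build _ _ f fD) (GRing.isMonoidMorphism.Build _ _ f fM).
exists psi; split=> [k|].
  by rewrite /= /f /ev /= /horner_morph map_polyC hornerC.
by rewrite -[LHS]/(ev (in_qpoly h 'X)) ev_mod /= /horner_morph map_polyX hornerX.
Qed.

(** Elements are stored as reduced polynomials, so torsion can be tested on coefficients. *)
Lemma qpoly_torsion_free (K : comNzRingType) (h : {poly K}) (n : nat) :
  (forall a : K, n%:R * a = 0 -> a = 0) ->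
  forall r : {poly %/ h}, n%:R * r = 0 -> r = 0.
Proof.
move=> tf r; rewrite mulr_natl => /(congr1 (fun s : {poly %/ h} => s : {poly K})).
rewrite raddfMn /= => rn0; apply/val_inj/polyP => i.
by rewrite coef0; apply: tf; rewrite mulr_natl -coefMn rn0 coef0.
Qed.

Lemma qpoly_Xn_sub1 (K : comNzRingType) n :
  (0 < n)%N -> ('qX : {poly %/ ('X^n - 1 : {poly K})}) ^+ n = 1.
Proof.
move=> n_gt0; pose h : {poly K} := 'X^n - 1.
have h_monic : h \is monic by apply: monicXnsubC.
have mk_h : mk_monic h = h by rewrite /mk_monic h_monic size_XnsubC // ltnS n_gt0.
rewrite -[LHS](rmorphXn (in_qpoly h)) -[RHS](rmorph1 (in_qpoly h)).
apply/eqP; rewrite -subr_eq0 -rmorphB; apply/eqP/val_inj => /=.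
by rewrite mk_h Pdiv.RingMonic.rmodpp.
Qed.

Lemma geom_rmorph (K T : comNzRingType) (f : {rmorphism K -> T}) n u :
  f (geom n u) = geom n (f u).
Proof. by rewrite rmorph_sum; apply: eq_bigr => i _; rewrite rmorphXn. Qed.

(* [qpoly_lift] only yields a map out of the group ring, so the ideal I(q) is replaced
   by the preimage of the annihilator of [s]. *)
Lemma monomial_annihilates (p e : nat) (S : comNzRingType) (x y s : S) al be :
  prime p -> (0 < e)%N -> x ^+ (p ^ e) = 1 -> y ^+ (p ^ e) = 1 ->
  (forall i j, geom (p ^ e) (x ^+ i * y ^+ j) * s = 0) ->
  (al + be = e * totient (p ^ e))%N ->
  (x - 1) ^+ al * (y - 1) ^+ be * s = 0.
Proof.
move=> p_pr e_gt0; set q := (p ^ e)%N => x_q y_q xy_s Hab.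
have q_gt0 : (0 < q)%N by rewrite expn_gt0 prime_gt0.
(* Two successive quotients by X^q - 1 build the integral group ring of (Z/q)^2. *)
pose h1 : {poly int} := 'X^q - 1.
pose h2 : {poly {poly %/ h1}} := 'X^q - 1.
have root_h (K : comNzRingType) (f : {rmorphism K -> S}) (u : S) :
    u ^+ q = 1 -> root (map_poly f ('X^q - 1)) u.
  move=> u_q; rewrite rmorphB rmorphXn rmorph1 /= map_polyX.
  by rewrite rootE !hornerE u_q subrr.
have [|||psi1 [_ psi1x]] := @qpoly_lift _ S h1 intr x.
- by rewrite size_XnsubC.
- exact: monicXnsubC.
- exact: root_h.
have [|||psi [psiC psiy]] := @qpoly_lift _ S h2 psi1 y.
- by rewrite size_XnsubC.
- exact: monicXnsubC.
- exact: root_h.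
pose I (r : {poly %/ h2}) := psi r * s = 0.
have idI : is_ideal I.
  split=> [|a b Ia Ib|a b Ib]; rewrite /I.
  - by rewrite rmorph0 mul0r.
  - by rewrite rmorphD mulrDl Ia Ib addr0.
  by rewrite rmorphM -mulrA Ib mulr0.
pose X : {poly %/ h2} := qpolyC h2 'qX.
have := @monomial_in_ideal p e p_pr e_gt0 _ X 'qX I al be idI.
rewrite /I !(rmorphM, rmorphXn, rmorphB, rmorph1) /= psiC psiy psi1x; apply => //.
- by rewrite -rmorphXn qpoly_Xn_sub1 ?rmorph1.
- exact: qpoly_Xn_sub1.
- move=> i j; rewrite geom_rmorph rmorphM !rmorphXn /= psiC psiy psi1x.
  exact: xy_s.
apply: qpoly_torsion_free; apply: qpoly_torsion_free => a /eqP.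
by rewrite mulf_eq0 Num.Theory.pnatr_eq0 eqn0Ngt prime_gt0 //= => /eqP.
Qed.

(** * Congruence subgroups *)

Inductive ideal_pow (L : pzRingType) (X Y : L) : nat -> L -> Prop :=
| ideal_pow0 a : ideal_pow X Y 0 a
| ideal_powX n a : ideal_pow X Y n a -> ideal_pow X Y n.+1 (X * a)
| ideal_powY n a : ideal_pow X Y n a -> ideal_pow X Y n.+1 (Y * a)
| ideal_powD n a b :
    ideal_pow X Y n a -> ideal_pow X Y n b -> ideal_pow X Y n (a + b).

Section IdealPowers.
Variables (L : comNzRingType) (X Y : L).
Local Notation J := (ideal_pow X Y).

Lemma ideal_powM n a b : J n b -> J n (a * b).
Proof.
elim=> {n b} [b|n b _ IHb|n b _ IHb|n b c _ IHb _ IHc]; first exact: ideal_pow0.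
- by rewrite mulrCA; apply: ideal_powX.
- by rewrite mulrCA; apply: ideal_powY.
by rewrite mulrDr; apply: ideal_powD.
Qed.

Lemma ideal_pow_zero n : J n 0.
Proof.
by elim: n => [|n IHn]; [exact: ideal_pow0 | rewrite -(mulr0 X); apply: ideal_powX].
Qed.

Lemma ideal_pow_is_ideal n : is_ideal (J n).
Proof.
by split; [exact: ideal_pow_zero | exact: ideal_powD | move=> a b; apply: ideal_powM].
Qed.

Lemma ideal_pow_mul m n a b : J m a -> J n b -> J (m + n) (a * b).
Proof.
move=> Ja Jb; elim: Ja => {m a} [a|m a _ IHa|m a _ IHa|m a c _ IHa _ IHc].
- exact: ideal_powM.
- by rewrite -mulrA; apply: ideal_powX.
- by rewrite -mulrA; apply: ideal_powY.
by rewrite mulrDl; apply: ideal_powD.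
Qed.

Lemma ideal_powS n a : J n.+1 a -> J n a.
Proof.
move def_m: n.+1 => m Ja.
elim: Ja n def_m => {m a} // [m a Ja _|m a Ja _|m a b _ IHa _ IHb] n def_m.
- by case: def_m Ja => -> ; apply: ideal_powM.
- by case: def_m Ja => -> ; apply: ideal_powM.
by apply: ideal_powD; [apply: IHa | apply: IHb].
Qed.

Lemma ideal_powW m n a : (m <= n)%N -> J n a -> J m a.
Proof.
elim: n => [|n IHn]; first by rewrite leqn0 => /eqP ->.
by rewrite leq_eqVlt => /predU1P [-> //|/IHn H /ideal_powS /H].
Qed.

Lemma ideal_pow_nilpotent N :
  (forall i j, (i + j = N)%N -> X ^+ i * Y ^+ j = 0) ->
  forall a, J N a -> a = 0.
Proof.
(* The generators peeled off [b] accumulate in a monomial of complementary degree. *)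
move=> XY0 a Ja; suff H n b : J n b -> forall i j, (n + i + j = N)%N ->
    b * (X ^+ i * Y ^+ j) = 0.
  by have := H _ _ Ja 0%N 0%N; rewrite !addn0 !expr0 !mulr1; apply.
elim=> {n b} [b|n b _ IHb|n b _ IHb|n b c _ IHb _ IHc] i j Hij.
- by rewrite XY0 ?mulr0.
- have := IHb i.+1 j; rewrite exprS => <-; [ring | lia].
- have := IHb i j.+1; rewrite exprS => <-; [ring | lia].
by rewrite mulrDl IHb // IHc // addr0.
Qed.
End IdealPowers.

Section CongruenceSubgroups.
Variables (L : comUnitRingType) (X Y : L).
Implicit Types g h A B : 'M[L]_2.

Definition mx_pow n A := forall i j, ideal_pow X Y n (A i j).

Definition cong_subgroup n g := g \in unitmx /\ mx_pow n (g - 1%:M).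

Lemma mx_powD n A B : mx_pow n A -> mx_pow n B -> mx_pow n (A + B).
Proof. by move=> HA HB i j; rewrite mxE; apply: ideal_powD. Qed.

Lemma mx_pow_mul m n A B : mx_pow m A -> mx_pow n B -> mx_pow (m + n) (A *m B).
Proof.
move=> HA HB i j; rewrite mxE; apply: (ideal_sum (ideal_pow_is_ideal X Y _)).
by move=> k _; apply: ideal_pow_mul.
Qed.

Lemma mx_powMr n A B : mx_pow n A -> mx_pow n (A *m B).
Proof.
move=> HA; rewrite -[n]addn0; apply: mx_pow_mul => // i j; exact: ideal_pow0.
Qed.

Lemma mx_powMl n A B : mx_pow n B -> mx_pow n (A *m B).
Proof. by move=> HB; apply: (@mx_pow_mul 0) => // i j; exact: ideal_pow0. Qed.

Lemma mx_powN n A : mx_pow n A -> mx_pow n (- A).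
Proof. by move=> HA i j; rewrite mxE -mulN1r; apply: ideal_powM. Qed.

Lemma gen_subgroup_sub (P G : 'M[L]_2 -> Prop) :
  (forall g, P g -> G g) -> G 1%:M ->
  (forall g h, G g -> G h -> G (g *m h)) -> (forall g, G g -> G (invmx g)) ->
  forall g, gen_subgroup P g -> G g.
Proof.
move=> PG G1 GM GV g; elim=> {g} [g /PG|//|g h _ Gg _ Gh|g _ Gg] //.
  exact: GM.
exact: GV.
Qed.

Lemma gen_cong_subgroup (P : 'M[L]_2 -> Prop) n :
  (forall g, P g -> cong_subgroup n g) ->
  forall g, gen_subgroup P g -> cong_subgroup n g.
Proof.
move=> HP; apply: gen_subgroup_sub => // [|g h [Ug Hg] [Uh Hh]|g [Ug Hg]].
- split; first exact: unitmx1.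
  by move=> i j; rewrite subrr mxE; apply: ideal_pow_zero.
- split; first by rewrite unitmx_mul Ug.
  have -> : g *m h - 1%:M = (g - 1%:M) *m h + (h - 1%:M).
    by rewrite mulmxBl mul1mx addrA subrK.
  by apply: mx_powD => //; apply: mx_powMr.
split; first by rewrite unitmx_inv.
have -> : invmx g - 1%:M = - (invmx g *m (g - 1%:M)).
  by rewrite mulmxBr mulVmx // mulmx1 opprB.
by apply/mx_powN/mx_powMl.
Qed.

(** The commutator minus 1 is a unit times the additive commutator [g *m h - h *m g]. *)
Lemma commutator2_cong n g h : g \in unitmx -> h \in unitmx ->
  mx_pow n (g *m h - h *m g) -> cong_subgroup n (commutator2 g h).
Proof.
move=> Ug Uh Hgh; split; first by rewrite !unitmx_mul !unitmx_inv Ug Uh.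
have -> : commutator2 g h - 1%:M = invmx g *m invmx h *m (g *m h - h *m g).
  rewrite mulmxBr /commutator2 -!mulmxA; congr (_ - _).
  by rewrite (mulmxA (invmx h)) mulVmx // mul1mx mulVmx.
exact: mx_powMl.
Qed.

(** The additive commutator is unchanged when 1 is subtracted from both matrices, and the levels
    then add. *)
Lemma commutator2_cong_subgroup m n g h :
  cong_subgroup m g -> cong_subgroup n h ->
  cong_subgroup (m + n) (commutator2 g h).
Proof.
move=> [Ug Hg] [Uh Hh]; apply: commutator2_cong => //.
have -> : g *m h - h *m g =
    (g - 1%:M) *m (h - 1%:M) - (h - 1%:M) *m (g - 1%:M).
  rewrite !mulmxBr !mulmxBl !mulmx1 !mul1mx.
  by apply/matrixP => i j; rewrite !mxE; ring.
apply: mx_powD; first exact: mx_pow_mul.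
by apply: mx_powN; rewrite addnC; apply: mx_pow_mul.
Qed.

Definition commutes_mod g h := mx_pow 1 (g *m h - h *m g).

Lemma commutes_mod_refl g : commutes_mod g g.
Proof. by move=> i j; rewrite subrr mxE; apply: ideal_pow_zero. Qed.

Lemma cong1_commutes_mod g h : mx_pow 1 (g - 1%:M) -> commutes_mod g h.
Proof.
move=> Hg; rewrite /commutes_mod.
have -> : g *m h - h *m g = (g - 1%:M) *m h - h *m (g - 1%:M).
  by rewrite mulmxBl mulmxBr mulmx1 mul1mx opprB addrA subrK.
by apply: mx_powD; [apply: mx_powMr | apply/mx_powN/mx_powMl].
Qed.

Lemma commutes_mod_sym g h : commutes_mod g h -> commutes_mod h g.
Proof. by move=> /mx_powN; rewrite opprB. Qed.

Lemma gen_commutes_mod (P : 'M[L]_2 -> Prop) h :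
  (forall g, P g -> g \in unitmx /\ commutes_mod g h) ->
  forall g, gen_subgroup P g -> g \in unitmx /\ commutes_mod g h.
Proof.
move=> HP; apply: gen_subgroup_sub => // [|g k [Ug Hg] [Uk Hk]|g [Ug Hg]].
- split; first exact: unitmx1.
  by move=> i j; rewrite mul1mx mulmx1 subrr mxE; apply: ideal_pow_zero.
- split; first by rewrite unitmx_mul Ug.
  rewrite /commutes_mod (_ : _ - _ =
    g *m (k *m h - h *m k) + (g *m h - h *m g) *m k).
    by apply: mx_powD; [apply: mx_powMl | apply: mx_powMr].
  by rewrite mulmxBr mulmxBl !mulmxA addrA subrK.
split; first by rewrite unitmx_inv.
rewrite /commutes_mod (_ : _ - _ = - (invmx g *m (g *m h - h *m g) *m invmx g)).
  by apply/mx_powN/mx_powMr/mx_powMl.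
rewrite mulmxBr mulmxBl !mulmxA mulVmx // mul1mx opprB.
by rewrite -!mulmxA mulmxV // mulmx1.
Qed.

(** The first derived subgroup has level 1 because the group is commutative modulo (X, Y); each
    further step doubles the level. *)
Lemma derived_cong_subgroup (P : 'M[L]_2 -> Prop) :
  (forall g, P g -> g \in unitmx) ->
  (forall g h, P g -> P h -> commutes_mod g h) ->
  forall k g, derived (gen_subgroup P) k.+1 g -> cong_subgroup (2 ^ k) g.
Proof.
move=> PU Pcomm; elim=> [|k IHk]; apply: gen_cong_subgroup => _ [g [h [Hg [Hh ->]]]].
  (* Commutation is extended from generators to the group in one argument at a time. *)
  have H g' : P g' -> g' \in unitmx /\ commutes_mod g' h.
    move=> Pg'; split; first exact: PU.
    apply: commutes_mod_sym.
    apply: (proj2 (@gen_commutes_mod P g' _ h Hh)) => h' Ph'; split; first exact: PU.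
    exact: Pcomm.
  have [Ug Cgh] := gen_commutes_mod H Hg.
  (* Comparison with the identity matrix extracts the invertibility of [h]. *)
  have [Uh _] : h \in unitmx /\ commutes_mod h 1%:M.
    apply: gen_commutes_mod Hh => h' Ph'; split; first exact: PU.
    by move=> i j; rewrite mul1mx mulmx1 subrr mxE; apply: ideal_pow_zero.
  exact: commutator2_cong.
by rewrite expnS mul2n -addnn; apply: commutator2_cong_subgroup; apply: IHk.
Qed.
End CongruenceSubgroups.

(** * Nilpotency in S(q) and the derived series of F *)

Lemma det_mx2 (R : comNzRingType) (a b c d : R) :
  \det (mx2 a b c d) = a * d - b * c.
Proof.
rewrite (expand_det_row _ ord0) !big_ord_recl big_ord0 /cofactor !det_mx11.
by rewrite !mxE /= expr0 expr1; ring.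
Qed.

(** One factor [x - 1] or [y - 1] is split off as the element annihilated by I(q); the remaining
    degree is the one in [monomial_annihilates]. *)
Lemma Sq_monomial_eq0 (p e : nat) (S : comUnitRingType) (x y : S) i j :
  prime p -> (0 < e)%N -> Sq_rel (p ^ e) x y ->
  (i + j = (e * totient (p ^ e)).+1)%N ->
  (x - 1) ^+ i * (y - 1) ^+ j = 0.
Proof.
move=> p_pr e_gt0 [_ [_ Hrel]].
have geomX a b : geom (p ^ e) (x ^+ a * y ^+ b) * (x - 1) = 0 :=
  (Hrel a%:Z b%:Z).1.
have geomY a b : geom (p ^ e) (x ^+ a * y ^+ b) * (y - 1) = 0 :=
  (Hrel a%:Z b%:Z).2.
have x_q : x ^+ (p ^ e) = 1.
  apply/eqP; rewrite -subr_eq0 -geom_sub1 mulrC.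
  by have := geomX 1 0; rewrite mulr1 => ->.
have y_q : y ^+ (p ^ e) = 1.
  apply/eqP; rewrite -subr_eq0 -geom_sub1 mulrC.
  by have := geomY 0 1; rewrite mul1r => ->.
case: i => [|i] Hij; last first.
  rewrite exprSr mulrAC; apply: (@monomial_annihilates p e) => //; lia.
case: j Hij => // j Hij.
by rewrite exprSr mulrA; apply: (@monomial_annihilates p e) => //; lia.
Qed.

Unset Implicit Arguments.
Theorem theorem1 (p e : nat) (hp : prime p) (he : (1 <= e)%N)
  (S : comUnitRingType) (x y : S) (hS : is_Sq (p ^ e) x y)
  (L : comUnitRingType) (iota : {rmorphism S -> L}) (t : L)
  (hL : is_Laurent iota t) :
  solvable_grp (F_group iota x y t) /\
  forall k : nat, (0 < k)%N ->
    (e * (p ^ e - p ^ e.-1) + 1 <= 2 ^ k.-1)%N ->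
    derived_length_le (F_group iota x y t) k.
Proof.
have [rel _] := hS; have [x_unit [y_unit _]] := rel.
have [t_unit _] := hL.
have tot : totient (p ^ e) = (p ^ e - p ^ e.-1)%N.
  by rewrite totient_pfactor // -(subn1 p) mulnBl mul1n -expnS prednK.
pose X := iota x - 1; pose Y := iota y - 1.
have nilp a : ideal_pow X Y (e * (p ^ e - p ^ e.-1) + 1) a -> a = 0.
  apply: ideal_pow_nilpotent => i j; rewrite -tot addn1 => Hij.
  rewrite /X /Y -(rmorph1 iota) -!rmorphB -!rmorphXn -rmorphM.
  by rewrite (Sq_monomial_eq0 hp he rel Hij) rmorph0.
have main k : (0 < k)%N -> (e * (p ^ e - p ^ e.-1) + 1 <= 2 ^ k.-1)%N ->
    derived_length_le (F_group iota x y t) k.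
  case: k => // k _ le_k g Dg.
  have [||_ Hg] := @derived_cong_subgroup L X Y _ _ _ k g Dg.
  - move=> g' [] ->; rewrite unitmxE det_mx2 ?mul0r ?mulr0 subr0.
      by rewrite mul1r rmorph_unit.
    by rewrite mulr1 unitrM rmorph_unit // t_unit.
  (* The first generator is the identity modulo (X, Y), so it commutes there with the second. *)
  - have M1_cong : mx_pow X Y 1 (mx2 1 (1 - iota y) 0 (iota x) - 1%:M).
      have in0 := ideal_pow_zero X Y 1.
      have inX : ideal_pow X Y 1 X.
        by rewrite -[X in ideal_pow _ _ _ X]mulr1; apply/ideal_powX/ideal_pow0.
      have inY : ideal_pow X Y 1 (1 - iota y).
        rewrite -opprB -mulN1r mulrC; apply/ideal_powY/ideal_pow0.
      by case=> [[|[|//]] ?] [[|[|//]] ?]; rewrite !mxE //= ?subrr ?subr0.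
    move=> g' h' [] -> [] ->; try exact: commutes_mod_refl.
      exact: cong1_commutes_mod.
    by apply: commutes_mod_sym; apply: cong1_commutes_mod.
  apply/eqP; rewrite -subr_eq0; apply/eqP/matrixP => i j.
  by rewrite [RHS]mxE; apply/nilp/(ideal_powW le_k).
(* For N = [e * (p ^ e - p ^ e.-1) + 1], the bound N < 2^N admits [k = N.+1]. *)
split=> //; exists (e * (p ^ e - p ^ e.-1) + 1).+1%N.
by apply: main => //=; apply/ltnW/ltn_expl.
Qed.
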